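(* $\mathsf{FindL}_{\bm{\Pi}^0_1}\equiv_{\mathrm{sW}}\mathsf{C}_{\omega^\omega}$.
   Context: Strong Weihrauch reducibility: for partial multi-valued functions $f,g$ between represented spaces, a realizer of $g$ is a partial $G$ on $\omega^\omega$ sending each name of each $x\in\mathrm{dom}(g)$ to a name of an element of $g(x)$. $f\leq_{\mathrm{sW}}g$ if there are computable partial $\varphi,\psi$ on $\omega^\omega$ such that for every realizer $G$ of $g$, $p\mapsto\psi(G(\varphi(p)))$ is a realizer of $f$. $\equiv_{\mathrm{sW}}$ is mutual strong reducibility. A closed subset of $\omega^\omega$ is named by an enumeration of a set of strings coding its complement as an open set; equivalently (computably) by a tree $V\subseteq\omega^{<\omega}$ whose body $[V]$ (set of infinite paths) is the closed set. A Laver tree (always with empty stem) is a prefix-closed $T\subseteq\omega^{<\omega}$ containing $\langle\rangle$ such that every $\sigma\in T$ has infinitely many immediate successors in $T$. $\mathrm{LT}:\omega^\omega\to\{\text{Laver trees}\}$ is a total bijective representation of Laver trees, computably equivalent to the representation via characteristic functions. $\mathsf{FindL}_{\bm{\Pi}^0_1}:\subseteq\bm{\Pi}^0_1(\omega^\omega)\rightrightarrows\omega^\omega$ maps a closed set $A$ to $\{f:[\mathrm{LT}(f)]\subseteq A\}$, with domain the set of closed $A$ such that some Laver tree $T$ has $[T]\subseteq A$. $\mathsf{C}_{\omega^\omega}$ maps a tree $T\subseteq\omega^{<\omega}$ (given by its characteristic function) with $[T]\neq\emptyset$ to $[T]$, i.e. any path is an admissible output. *)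

(* Defs.v *)
From HB Require Import structures.
From mathcomp Require Import all_boot.
From mathcomp Require Import boolp classical_sets functions cardinality.
From mathcomp Require Import topology.

Set Implicit Arguments.
Unset Strict Implicit.
Unset Printing Implicit Defensive.

Local Open Scope classical_set_scope.

Definition baire_space : Type := prod_topology (fun _ : nat => nat).

HB.instance Definition _ := Pointed.on baire_space.
HB.instance Definition _ := Nbhs.on baire_space.
HB.instance Definition _ := Topological.on baire_space.

(** Kleene's partial recursive functions relative to an oracle. A program acts
    on a list of arguments; arguments beyond the end of the list read as 0. *)
Inductive prog : Type :=
| Zero
| Succ
| Proj of nat
| Oracle
| Comp of prog & seq prog
| Prec of prog & prog
| Mu of prog.

Fixpoint pointwise (Rs : seq (nat -> Prop)) (ys : seq nat) : Prop :=
  match Rs, ys with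
  | [::], [::] => True
  | R :: Rs', y :: ys' => R y /\ pointwise Rs' ys'
  | _, _ => False
  end.

(** [eval p e xs y]: with oracle [p], program [e] halts on [xs] with value [y].
    [Prec] recurses on the first argument; [Mu] searches for the least value of
    a new first argument at which its body vanishes, the body being defined at
    every smaller one. *)
Fixpoint eval (p : nat -> nat) (e : prog) (xs : seq nat) : nat -> Prop :=
  match e with
  | Zero => fun y => y = 0
  | Succ => fun y => y = (nth 0 xs 0).+1
  | Proj i => fun y => y = nth 0 xs i
  | Oracle => fun y => y = p (nth 0 xs 0)
  | Comp f gs => fun y => exists ys : seq nat,
      pointwise (map (fun g => eval p g xs) gs) ys /\ eval p f ys y
  | Prec f g =>
      (fix rec (n : nat) : nat -> Prop :=
         match n with
         | 0 => eval p f (behead xs)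
         | n'.+1 => fun y => exists z : nat,
             rec n' z /\ eval p g [:: n', z & behead xs] y
         end) (nth 0 xs 0)
  | Mu f => fun y =>
      eval p f (y :: xs) 0 /\
      forall z, z < y -> exists v, eval p f (z :: xs) v.+1
  end.

Definition pfun := baire_space -> option baire_space.

(** As usual for type-2 computability, the program need only be correct on the
    domain of [F]. *)
Definition computable (F : pfun) : Prop :=
  exists e : prog, forall p q, F p = Some q ->
    forall n, eval p e [:: n] (q n).

Record repr_space := ReprSpace {
  carrier :> Type;
  names : baire_space -> carrier -> Prop;
  names_fun : forall p x y, names p x -> names p y -> x = y;
  names_surj : forall x, exists p, names p x
}.
Arguments names {r}.

Definition repr_le X (d d' : baire_space -> X -> Prop) : Prop :=
  exists2 F : pfun, computable F &
    forall p x, d p x -> exists2 q, F p = Some q & d' q x.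

Definition repr_equiv X (d d' : baire_space -> X -> Prop) : Prop :=
  repr_le d d' /\ repr_le d' d.

Record multifun (X Y : Type) := Multifun {
  mdom : set X;
  mval : X -> set Y
}.

Definition realizer (X Y : repr_space) (f : multifun X Y) (F : pfun) : Prop :=
  forall x p, mdom f x -> names p x ->
    exists q y, [/\ F p = Some q, names q y & mval f x y].

Definition sW_le (X Y Z W : repr_space)
    (f : multifun X Y) (g : multifun Z W) : Prop :=
  exists phi psi : pfun, [/\ computable phi, computable psi &
    forall G, realizer g G -> realizer f (pcomp psi (pcomp G phi))].

Definition sW_equiv (X Y Z W : repr_space)
    (f : multifun X Y) (g : multifun Z W) : Prop :=
  sW_le f g /\ sW_le g f.

Definition baire_names (p x : baire_space) : Prop := p = x.

Lemma baire_names_fun p x y : baire_names p x -> baire_names p y -> x = y.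
Proof. by move=> <- <-. Qed.

Lemma baire_names_surj x : exists p, baire_names p x.
Proof. by exists x. Qed.

Definition baire : repr_space := ReprSpace baire_names_fun baire_names_surj.

Record closed_set := ClosedSet {
  closed_set_val :> set baire_space;
  closed_setP : closed closed_set_val
}.

Definition cylinder (s : seq nat) : set baire_space :=
  [set x | mkseq x (size s) = s].

(** The value 0 enumerates nothing, so that the empty set of strings has an
    enumeration too; the value [(code s).+1] enumerates the string [s]. *)
Definition enum_open (p : baire_space) : set baire_space :=
  [set x | exists n s, p n = (CodeSeq.code s).+1 /\ cylinder s x].

Definition Pi01_names (p : baire_space) (A : closed_set) : Prop :=
  A = ~` enum_open p :> set baire_space.

Lemma closed_set_inj (A B : closed_set) :
  A = B :> set baire_space -> A = B.
Proof.
case: A B => [A cA] [B cB] /= AB; case: _ / AB cB => cB.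
by congr ClosedSet; exact: Prop_irrelevance.
Qed.

Lemma Pi01_names_fun p A B : Pi01_names p A -> Pi01_names p B -> A = B.
Proof. by move=> pA pB; apply: closed_set_inj; rewrite pA pB. Qed.

Lemma cylinder_mkseqP (x y : baire_space) n :
  cylinder (mkseq x n) y <-> forall i, i < n -> y i = x i.
Proof.
rewrite /cylinder /= size_mkseq; split=> [xy i ltin|xy].
  by rewrite -(nth_mkseq 0 y ltin) xy nth_mkseq.
by apply/eq_in_map => i; rewrite mem_iota => /andP[_]; exact: xy.
Qed.

Lemma cylinder_self (x : baire_space) n : cylinder (mkseq x n) x.
Proof. exact/cylinder_mkseqP. Qed.

Lemma nbhs_baireP (x : baire_space) (U : set baire_space) :
  nbhs x U <-> exists n, cylinder (mkseq x n) `<=` U.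
Proof.
split=> [|[n]]; last first.
  move=> /filterS; apply; elim: n => [|n IHn].
    by apply: filterS filterT => y _; apply/cylinder_mkseqP.
  have xn : nbhs x [set y : baire_space | y n = x n].
    have nxn : nbhs (x n) [set x n] by rewrite nbhs_principalE; exact/principal_filterP.
    exact: (@proj_continuous nat (fun=> nat) n x _ nxn).
  apply: filterS (filterI IHn xn) => y [/cylinder_mkseqP yx /= yn].
  apply/cylinder_mkseqP => i; rewrite ltnS leq_eqVlt.
  by case/predU1P => [-> //|]; exact: yx.
pose F := filter_from [set: nat] (fun n => cylinder (mkseq x n)).
have FF : Filter F.
  apply: filter_from_filter; first by exists 0.
  move=> i j _ _; exists (maxn i j) => // y /cylinder_mkseqP yx.
  by split; apply/cylinder_mkseqP => k ltk; apply: yx; rewrite leq_max ltk ?orbT.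
suff: F --> x by move=> /[apply] -[n _ ?]; exists n.
apply/cvg_sup => i V [/= _ [[W /= oW <-] /= Wx]] /filterS; apply.
exists i.+1 => // y /cylinder_mkseqP /(_ i (ltnSn i)) yx.
by rewrite /preimage /= yx.
Qed.

Lemma closed_enum p : closed (~` enum_open p).
Proof.
rewrite closedC openE => x [n [s [pn /= sx]]]; apply/nbhs_baireP.
by exists (size s); rewrite sx => y sy; exists n, s.
Qed.

Lemma Pi01_names_surj A : exists p, Pi01_names p A.
Proof.
pose p n := let s := CodeSeq.decode n in
  if `[< cylinder s `<=` ~` A >] then (CodeSeq.code s).+1 else 0.
exists p; rewrite /Pi01_names; apply/seteqP; split=> x.
  move=> Ax [n [s []]]; rewrite /p; case: asboolP => // sA [/(can_inj CodeSeq.codeK) <-].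
  by move/sA.
move=> nx; apply: contrapT => nAx; apply: nx.
have : open (~` A) by rewrite openC; exact: closed_setP.
rewrite openE => /(_ x nAx)/nbhs_baireP[n xA].
exists (CodeSeq.code (mkseq x n)), (mkseq x n); split.
  by rewrite /p CodeSeq.codeK; case: asboolP.
exact: cylinder_self.
Qed.

Definition Pi01 : repr_space := ReprSpace Pi01_names_fun Pi01_names_surj.

Definition prefix_closed (T : set (seq nat)) : Prop :=
  forall s t, prefix s t -> T t -> T s.

(** The stem is empty: splitting is required from the root on. *)
Definition is_laver (T : set (seq nat)) : Prop :=
  [/\ prefix_closed T, T [::] &
      forall s, T s -> infinite_set [set n | T (rcons s n)]].

Record tree := Tree {
  tree_val :> set (seq nat);
  treeP : prefix_closed tree_val
}.

Record laver_tree := LaverTree {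
  laver_val :> set (seq nat);
  laverP : is_laver laver_val
}.

Definition body (T : set (seq nat)) : set baire_space :=
  [set x | forall n, T (mkseq x n)].

Definition char_names (p : baire_space) (T : set (seq nat)) : Prop :=
  forall s, p (CodeSeq.code s) = `[< T s >] :> nat.

Lemma char_names_fun p S T : char_names p S -> char_names p T -> S = T.
Proof.
move=> pS pT; apply/seteqP; split=> s.
  by have := pT s; rewrite pS; do 2 case: asboolP.
by have := pT s; rewrite pS; do 2 case: asboolP.
Qed.

Lemma char_names_surj T : exists p, char_names p T.
Proof.
by exists (fun n => `[< T (CodeSeq.decode n) >] : nat) => s; rewrite CodeSeq.codeK.
Qed.

Definition tree_names (p : baire_space) (T : tree) : Prop := char_names p T.

Lemma tree_names_fun p S T : tree_names p S -> tree_names p T -> S = T.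
Proof.
case: S T => [S cS] [T cT] pS pT; move: (char_names_fun pS pT) => /= ST.
case: _ / ST cT {pT} => cT; congr Tree; exact: Prop_irrelevance.
Qed.

Lemma tree_names_surj T : exists p, tree_names p T.
Proof. exact: char_names_surj. Qed.

Definition trees : repr_space := ReprSpace tree_names_fun tree_names_surj.

Definition laver_representation (LT : baire_space -> laver_tree) : Prop :=
  bijective LT /\
  repr_equiv (fun p T => LT p = T) (fun p T => char_names p T).

Definition FindL_Pi01 (LT : baire_space -> laver_tree) :
    multifun Pi01 baire :=
  @Multifun Pi01 baire
    (fun A : closed_set => exists T : laver_tree, body T `<=` A)
    (fun A : closed_set => [set f | body (LT f) `<=` A]).

Definition C_baire : multifun trees baire :=
  @Multifun trees baire
    (fun T : tree => body T !=set0)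
    (fun T : tree => body T).

(* Main.v *)
From mathcomp Require Import all_boot.
From mathcomp Require Import boolp classical_sets functions cardinality.
From mathcomp Require Import topology zify.
Require Import Defs.

(** Both reductions rest on a choice of coding under which the outer computable
    maps are easy.

    From branches to Laver trees.  A function [x] on codes of strings defines
    [zero_tree x], the set of strings [s] such that [x] vanishes at every
    initial segment of [s], where segments are coded in reverse.  The intended
    value of [x] at a nonempty string [c] outside the tree is the distance from
    the last entry of [c] up to some later entry that is admissible at the same
    node.  Adding [d] to the last entry of a string multiplies the code of its
    reversal by [2 ^ d] ([code_shift]), so the requirement on [x] is
    [x (2 ^ x c * c) = 0] for all [c]; it is closed in [x] and forces every node
    to split infinitely ([zero_tree_laver]).  The nonzero values of [x] thus act
    as Skolem functions for the Pi_2 condition of being Laver.  Since every node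
    of a Laver tree lies on a branch ([laver_branch]), the body of [zero_tree x]
    is contained in the closed set named by [p] exactly when no string enumerated
    by [p] belongs to [zero_tree x], which is again closed in [x].  Hence the
    admissible [x] are the branches of a tree computable from [p]
    ([laver_search]), every Laver tree inside the closed set gives such a branch
    ([laver_search_nonempty]), and a branch [x] alone computes the
    characteristic function of [zero_tree x] ([body_laver_search]).

    From Laver trees to branches.  The function [untag] has infinite fibres.
    Given a tree [T], the sequences [y] with [untag \o y] in [body T] form a
    closed set, with a name computable from [T] ([enum_untag_name]).  A branch
    [x] of [T] yields a Laver tree inside it, because each [x n] may be replaced
    by any of its infinitely many preimages ([untag_laverP]).  Conversely a Laver
    tree inside this set has no dead ends, so a branch [y] of it is found by
    search, and [untag \o y] is a branch of [T].  The tree [T] is not consulted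
    again, which makes the reduction strong.

    The representation [LT] enters only through its translations to and from
    characteristic functions; they are composed with the maps above by replacing
    oracle queries in one program by calls of another ([computable_pcomp]).  That
    the maps above are computable is shown by closure properties of the
    functions given by programs, [recursive_on]. *)

Set Implicit Arguments.
Unset Strict Implicit.
Unset Printing Implicit Defensive.

Local Open Scope classical_set_scope.

Local Notation code := CodeSeq.code.
Local Notation decode := CodeSeq.decode.

(** * Functions computed by a program *)

(** The arity [k] is fixed because a composition passes its arguments as a list
    of fixed length, while [f] sees the list as a whole so that the context
    extended by a recursion or a search is again such a list.  The set [D] of
    oracles is there for unbounded searches, which may end only on some
    oracles. *)
Definition recursive_on (D : set baire_space) (k : nat)
    (f : baire_space -> seq nat -> nat) : Prop :=
  exists e : prog, forall p xs, D p -> size xs = k -> eval p e xs (f p xs).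

Lemma recursive_ext D k f g :
  (forall p xs, D p -> size xs = k -> f p xs = g p xs) ->
  recursive_on D k f -> recursive_on D k g.
Proof.
by move=> fg [e eP]; exists e => p xs Dp sz; rewrite -fg //; exact: eP.
Qed.

Lemma recursive_proj D k i : recursive_on D k (fun _ xs => nth 0 xs i).
Proof. by exists (Proj i). Qed.

Lemma recursive_app D k m f (g : nat -> baire_space -> seq nat -> nat) :
  recursive_on D m f -> (forall i, i < m -> recursive_on D k (g i)) ->
  recursive_on D k (fun p xs => f p (mkseq (fun i => g i p xs) m)).
Proof.
move=> [e eP] gP.
suff [es esP] : exists es, forall p xs, D p -> size xs = k ->
    pointwise (map (fun d => eval p d xs) es) (mkseq (fun i => g i p xs) m).
  exists (Comp e es) => p xs Dp sz /=.
  exists (mkseq (fun i => g i p xs) m); split; first exact: esP.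
  by apply: eP => //; rewrite size_mkseq.
elim: m g {e eP} gP => [|m IHm] g gP; first by exists [::].
have [d dP] := gP 0 isT.
have [i|es esP] := IHm (fun i => g i.+1); first exact: (gP i.+1).
exists (d :: es) => p xs Dp sz; split; first exact: dP.
by rewrite -[1]add1n iotaDl -map_comp; exact: esP.
Qed.

Lemma recursive_app1 D k f g :
  recursive_on D 1 (fun p ys => f p (nth 0 ys 0)) -> recursive_on D k g ->
  recursive_on D k (fun p xs => f p (g p xs)).
Proof. by move=> fP gP; apply: (recursive_app (g := fun=> g) fP). Qed.

Lemma recursive_app2 D k f g h :
  recursive_on D 2 (fun p ys => f p (nth 0 ys 0) (nth 0 ys 1)) ->
  recursive_on D k g -> recursive_on D k h ->
  recursive_on D k (fun p xs => f p (g p xs) (h p xs)).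
Proof.
move=> fP gP hP.
by apply: (recursive_app (g := fun i => nth h [:: g] i) fP) => -[|[]] //=.
Qed.

(** Recursion and search act on the first argument and keep the others; this
    lets a computed value take that place. *)
Lemma recursive_let D k f g :
  recursive_on D k.+1 f -> recursive_on D k g ->
  recursive_on D k (fun p xs => f p (g p xs :: xs)).
Proof.
move=> fP gP.
pose h i := if i is j.+1 then fun (_ : baire_space) xs => nth 0 xs j else g.
apply: recursive_ext (recursive_app (g := h) fP _).
  move=> p xs _ sz; congr f; rewrite /mkseq /=; congr cons.
  by rewrite -[1]add1n iotaDl -map_comp -[RHS](mkseq_nth 0) sz.
by case=> [//|j _]; exact: recursive_proj.
Qed.

Lemma recursive_oracle D k f :
  recursive_on D k f -> recursive_on D k (fun p xs => p (f p xs)).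
Proof.
move=> fP; apply: (recursive_app1 (f := fun p n => p n) _ fP).
by exists Oracle.
Qed.

Lemma recursive_succ D k f :
  recursive_on D k f -> recursive_on D k (fun p xs => (f p xs).+1).
Proof.
move=> fP; apply: (recursive_app1 (f := fun _ n => n.+1) _ fP).
by exists Succ.
Qed.

Lemma recursive_const D k c : recursive_on D k (fun _ _ => c).
Proof.
elim: c => [|c IHc]; [by exists Zero | exact: (recursive_succ IHc)].
Qed.

Lemma recursive_iteri D k n b h :
  recursive_on D k n -> recursive_on D k b -> recursive_on D k.+2 h ->
  recursive_on D k (fun p xs =>
    iteri (n p xs) (fun i acc => h p [:: i, acc & xs]) (b p xs)).
Proof.
move=> nP [e eP] [d dP].
apply: (@recursive_let _ _ (fun p ys => iteri (head 0 ys)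
  (fun i acc => h p [:: i, acc & behead ys]) (b p (behead ys)))) nP.
exists (Prec e d) => p [|m xs] //= Dp [sz].
elim: m => [|m IHm] /=; first exact: eP.
exists (iteri m (fun i acc => h p [:: i, acc & xs]) (b p xs)).
by split; [exact: IHm | apply: dP => //=; rewrite sz].
Qed.

Definition least (P : pred nat) : nat :=
  if pselect (exists m, P m) is left exP then ex_minn exP else 0.

Lemma leastP (P : pred nat) :
  (exists m, P m) -> P (least P) /\ forall m, P m -> least P <= m.
Proof. by rewrite /least; case: pselect => // exP _; case: ex_minnP. Qed.

Lemma least_eq (P : pred nat) n :
  P n -> (forall m, m < n -> ~~ P m) -> least P = n.
Proof.
move=> Pn lt_n; have [Pl le_l] := leastP (ex_intro _ n Pn).
apply/eqP; rewrite eqn_leq le_l //= leqNgt.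
by apply/negP => /lt_n /negP.
Qed.

Lemma recursive_least D k (P : baire_space -> seq nat -> bool) :
  recursive_on D k.+1 (fun p ys => ~~ P p ys) ->
  (forall p xs, D p -> size xs = k -> exists m, P p (m :: xs)) ->
  recursive_on D k (fun p xs => least (fun m => P p (m :: xs))).
Proof.
move=> [e eP] exP; exists (Mu e) => p xs Dp sz /=.
have [Pl le_l] := leastP (exP p xs Dp sz).
have sz1 z : size (z :: xs) = k.+1 by rewrite /= sz.
set l := least _ in Pl le_l *.
split=> [|z lt_z]; first by have := eP p _ Dp (sz1 l); rewrite Pl.
exists 0; have := eP p _ Dp (sz1 z); suff /negbTE -> : ~~ P p (z :: xs) by [].
by apply: contraTN lt_z => /le_l; rewrite -leqNgt.
Qed.

(** * Arithmetic and truth values *)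

Lemma recursive_add D k f g :
  recursive_on D k f -> recursive_on D k g ->
  recursive_on D k (fun p xs => f p xs + g p xs).
Proof.
move=> fP gP.
apply: recursive_ext (recursive_iteri (h := fun _ ys => (nth 0 ys 1).+1)
  fP gP (recursive_succ (recursive_proj _ _ _))) => p xs _ _.
by elim: (f p xs) => //= n ->.
Qed.

Lemma recursive_pred D k f :
  recursive_on D k f -> recursive_on D k (fun p xs => (f p xs).-1).
Proof.
move=> fP; apply: recursive_ext (recursive_iteri fP (recursive_const _ _ 0)
  (recursive_proj _ _ 0)) => p xs _ _.
by case: (f p xs).
Qed.

Lemma recursive_sub D k f g :
  recursive_on D k f -> recursive_on D k g ->
  recursive_on D k (fun p xs => f p xs - g p xs).
Proof.
move=> fP gP; apply: recursive_ext (recursive_iteri gP fP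
  (recursive_pred (recursive_proj _ _ 1))) => p xs _ _.
by elim: (g p xs) => [|n /= ->]; rewrite ?subn0 ?subnS.
Qed.

Lemma recursive_mul D k f g :
  recursive_on D k f -> recursive_on D k g ->
  recursive_on D k (fun p xs => f p xs * g p xs).
Proof.
apply: (recursive_app2 (f := fun _ m n => m * n)).
apply: recursive_ext (recursive_iteri (recursive_proj _ _ 0)
  (recursive_const _ _ 0)
  (recursive_add (recursive_proj _ _ 3) (recursive_proj _ _ 1))) => p xs _ _.
by elim: (nth 0 xs 0) => //= n ->; rewrite mulSn.
Qed.

Lemma recursive_exp2 D k f :
  recursive_on D k f -> recursive_on D k (fun p xs => 2 ^ f p xs).
Proof.
move=> fP; apply: recursive_ext (recursive_iteri fP (recursive_const _ _ 1)
  (recursive_add (recursive_proj _ _ 1) (recursive_proj _ _ 1))) => p xs _ _.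
by elim: (f p xs) => //= n ->; rewrite expnS mul2n addnn.
Qed.

(** Halving is a primitive recursion because [n.+1./2 = n - n./2]. *)
Lemma recursive_half D k f :
  recursive_on D k f -> recursive_on D k (fun p xs => (f p xs)./2).
Proof.
move=> fP; apply: recursive_ext (recursive_iteri fP (recursive_const _ _ 0)
  (recursive_sub (recursive_proj _ _ 0) (recursive_proj _ _ 1))) => p xs _ _.
elim: (f p xs) => //= n ->.
by rewrite -/(uphalf n) uphalf_half; have := odd_double_half n; lia.
Qed.

Lemma recursive_eq0 D k f :
  recursive_on D k f -> recursive_on D k (fun p xs => f p xs == 0).
Proof.
move=> fP; apply: recursive_ext (recursive_sub (recursive_const _ _ 1) fP).
by move=> p xs _ _ /=; case: (f p xs).
Qed.

Lemma recursive_neg D k (P : baire_space -> seq nat -> bool) :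
  recursive_on D k (fun p xs => P p xs) ->
  recursive_on D k (fun p xs => ~~ P p xs).
Proof.
by move=> /recursive_eq0; apply: recursive_ext => p xs _ _; case: P.
Qed.

Lemma recursive_and D k (P Q : baire_space -> seq nat -> bool) :
  recursive_on D k (fun p xs => P p xs) ->
  recursive_on D k (fun p xs => Q p xs) ->
  recursive_on D k (fun p xs => P p xs && Q p xs).
Proof.
move=> PP QP; apply: recursive_ext (recursive_mul PP QP) => p xs _ _.
by rewrite mulnb.
Qed.

Lemma recursive_or D k (P Q : baire_space -> seq nat -> bool) :
  recursive_on D k (fun p xs => P p xs) ->
  recursive_on D k (fun p xs => Q p xs) ->
  recursive_on D k (fun p xs => P p xs || Q p xs).
Proof.
move=> PP QP; apply: recursive_ext (recursive_neg (recursive_and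
  (recursive_neg PP) (recursive_neg QP))) => p xs _ _.
by rewrite negb_and !negbK.
Qed.

Lemma recursive_if D k (P : baire_space -> seq nat -> bool) f g :
  recursive_on D k (fun p xs => P p xs) ->
  recursive_on D k f -> recursive_on D k g ->
  recursive_on D k (fun p xs => if P p xs then f p xs else g p xs).
Proof.
move=> PP fP gP; apply: recursive_ext (recursive_add (recursive_mul PP fP)
  (recursive_mul (recursive_neg PP) gP)) => p xs _ _.
by case: (P p xs); rewrite !(mul0n, mul1n, addn0).
Qed.

Lemma recursive_all D k n (P : baire_space -> seq nat -> bool) :
  recursive_on D k n -> recursive_on D k.+1 (fun p ys => P p ys) ->
  recursive_on D k
    (fun p xs => all (fun i => P p (i :: xs)) (iota 0 (n p xs))).
Proof.
move=> nP PP.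
pose g i (_ : baire_space) ys := nth 0 ys (if i is j.+1 then j.+2 else 0).
(* Inside the recursion the context is [i, acc & xs], while [P] expects
   [i :: xs]. *)
have PP' := recursive_app (k := k.+2) (g := g) PP
  (fun i _ => recursive_proj _ _ _).
apply: recursive_ext (recursive_iteri nP (recursive_const _ _ 1)
  (recursive_mul (recursive_proj _ _ 1) PP')) => p xs _ sz.
have gE i acc : mkseq (fun j => g j p [:: i, acc & xs]) k.+1 = i :: xs.
  rewrite /mkseq /= -[1]add1n iotaDl -map_comp -sz; congr cons.
  by rewrite -[RHS](mkseq_nth 0).
elim: (n p xs) => // m IHm.
by rewrite [LHS]/= IHm gE -[in RHS]addn1 iotaD all_cat /= andbT mulnb.
Qed.

(** * Lists *)

(** The code of [n :: s] is [2 ^ n] times the odd number [(code s).*2.+1]; head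
    and tail are read off by counting how often it can be halved. *)
Lemma halfs n m j : iter j half (2 ^ (j + n) * m) = 2 ^ n * m.
Proof.
elim: j n => // j IHj n; rewrite iterS addSnnS IHj.
by rewrite expnS -mulnA mul2n doubleK.
Qed.

(** The disjunct [c == 0] ends the search at the code of the empty string, which
    has no odd quotient. *)
Lemma head_decodeE c :
  head 0 (decode c) = least (fun j => (c == 0) || odd (iter j half c)).
Proof.
rewrite -[in RHS](CodeSeq.decodeK c); case: (decode c) => [|n s] /=.
  by rewrite (@least_eq _ 0).
rewrite (@least_eq _ n) // => [|j lt_jn].
  by rewrite -[in X in iter _ _ X](addn0 n) halfs mul1n /= odd_double orbT.
rewrite -(subnKC (ltnW lt_jn)) halfs muln_eq0 expn_eq0 /= oddM oddX.
by rewrite orbF subn_eq0 leqNgt lt_jn.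
Qed.

Lemma behead_decodeE c :
  code (behead (decode c)) = (iter (head 0 (decode c)) half c)./2.
Proof.
rewrite -[in X in iter _ _ X](CodeSeq.decodeK c).
case: (decode c) => [|n s] //=.
by rewrite -[in X in iter _ _ X](addn0 n) halfs mul1n /= uphalf_double.
Qed.

Lemma recursive_halfs D k f g :
  recursive_on D k f -> recursive_on D k g ->
  recursive_on D k (fun p xs => iter (f p xs) half (g p xs)).
Proof.
move=> fP gP; apply: recursive_ext (recursive_iteri fP gP
  (recursive_half (recursive_proj _ _ 1))) => p xs _ _.
by elim: (f p xs) => //= n ->.
Qed.

Lemma recursive_odd D k f :
  recursive_on D k f -> recursive_on D k (fun p xs => odd (f p xs)).
Proof.
move=> fP; apply: recursive_ext (recursive_sub fP (recursive_add
  (recursive_half fP) (recursive_half fP))) => p xs _ _.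
by rewrite addnn -[in X in X - _](odd_double_half (f p xs)) addnK.
Qed.

Lemma recursive_head D k f :
  recursive_on D k f ->
  recursive_on D k (fun p xs => head 0 (decode (f p xs))).
Proof.
apply: (recursive_app1 (f := fun _ c => head 0 (decode c))).
pose P (_ : baire_space) ys :=
  (nth 0 ys 1 == 0) || odd (iter (nth 0 ys 0) half (nth 0 ys 1)).
apply: recursive_ext (recursive_least (P := P) _ _) => [p xs _ _||p xs _ _].
- by rewrite head_decodeE.
- apply/recursive_neg/recursive_or; first exact/recursive_eq0/recursive_proj.
  by apply/recursive_odd/recursive_halfs; exact: recursive_proj.
rewrite /P /= -(CodeSeq.decodeK (nth 0 xs 0)).
case: (decode _) => [|n s] /=; first by exists 0.
exists n; rewrite -[in X in iter _ _ X](addn0 n) halfs mul1n /=.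
by rewrite odd_double orbT.
Qed.

Lemma recursive_behead D k f :
  recursive_on D k f ->
  recursive_on D k (fun p xs => code (behead (decode (f p xs)))).
Proof.
move=> fP; apply: recursive_ext (recursive_half (recursive_halfs
  (recursive_head fP) fP)) => p xs _ _.
by rewrite behead_decodeE.
Qed.

Lemma recursive_cons D k f g :
  recursive_on D k f -> recursive_on D k (fun p xs => code (g p xs)) ->
  recursive_on D k (fun p xs => code (f p xs :: g p xs)).
Proof.
move=> fP gP; apply: recursive_ext (recursive_mul (recursive_exp2 fP)
  (recursive_succ (recursive_add gP gP))) => p xs _ _.
by rewrite addnn.
Qed.

Lemma recursive_drop D k f g :
  recursive_on D k f -> recursive_on D k g ->
  recursive_on D k (fun p xs => code (drop (f p xs) (decode (g p xs)))).
Proof.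
move=> fP gP; apply: recursive_ext (recursive_iteri fP gP
  (recursive_behead (recursive_proj _ _ 1))) => p xs _ _.
elim: (f p xs) => [|n /= ->]; first by rewrite drop0 CodeSeq.decodeK.
by rewrite CodeSeq.codeK -drop1 drop_drop.
Qed.

Lemma size_decode c : size (decode c) <= c.
Proof.
rewrite -[leqRHS]CodeSeq.decodeK; elim: (decode c) => //= n s IHs.
apply: leq_trans (leq_pmull _ _); last by rewrite expn_gt0.
by rewrite ltnS -addnn; apply: leq_trans IHs (leq_addr _ _).
Qed.

Lemma code_eq0 s : (code s == 0) = (s == [::]).
Proof. by case: s => //= n s; rewrite muln_eq0 expn_eq0. Qed.

(** Only the empty string has code 0, so an exhausted list is recognized by the
    code of what remains of it. *)
Lemma recursive_nth D k d f g :
  recursive_on D k f -> recursive_on D k g ->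
  recursive_on D k (fun p xs => nth d (decode (g p xs)) (f p xs)).
Proof.
move=> fP gP; have dP := recursive_drop fP gP.
apply: recursive_ext (recursive_if (recursive_eq0 dP)
  (recursive_const _ _ d) (recursive_head dP)) => p xs _ _.
rewrite CodeSeq.codeK code_eq0 -[f p xs in RHS]addn0 -nth_drop nth0.
by case: (drop _ _).
Qed.

(** Moving the entries of a list one by one to the front of another reverses it,
    so the iteration yields the reversed image; applied with [id] it reverses,
    and applied twice it maps without reversing. *)
Lemma recursive_rev_map D h f k :
  recursive_on D 1 (fun _ ys => h (nth 0 ys 0)) -> recursive_on D k f ->
  recursive_on D k (fun p xs => code (rev (map h (decode (f p xs))))).
Proof.
move=> hP.
apply: (recursive_app1 (f := fun _ c => code (rev (map h (decode c))))).
have dP : recursive_on D 3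
    (fun _ ys => code (drop (nth 0 ys 0) (decode (nth 0 ys 2)))).
  by apply: recursive_drop; exact: recursive_proj.
have cP : recursive_on D 3 (fun _ ys => code
    (h (head 0 (decode (code (drop (nth 0 ys 0) (decode (nth 0 ys 2))))))
     :: decode (nth 0 ys 1))).
  apply: recursive_cons; last first.
    apply: recursive_ext (recursive_proj _ _ 1) => p ys _ _.
    by rewrite CodeSeq.decodeK.
  by apply: (recursive_app1 (f := fun _ n => h n)) => //; exact: recursive_head.
apply: recursive_ext (recursive_iteri (recursive_proj _ _ 0)
  (recursive_const _ _ 0)
  (recursive_if (recursive_eq0 dP) (recursive_proj _ _ 1) cP)) => p xs _ _.
set c := nth 0 xs 0; rewrite /= -/c; set s := decode c.
have -> : rev (map h s) = rev (map h (take c s)).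
  (* At least [size s] steps are needed; [c] is a bound, and the further steps
     change nothing. *)
  by rewrite take_oversize // size_decode.
elim: {1 2}c => [|n /= ->]; first by rewrite take0.
rewrite !CodeSeq.codeK code_eq0.
have [le_sn|lt_ns] := leqP (size s) n.
  by rewrite drop_oversize // !take_oversize // ltnW.
by rewrite (take_nth 0 lt_ns) (drop_nth 0 lt_ns) map_rcons rev_rcons.
Qed.

Lemma recursive_size D k f :
  recursive_on D k f -> recursive_on D k (fun p xs => size (decode (f p xs))).
Proof.
apply: (recursive_app1 (f := fun _ c => size (decode c))).
pose P (_ : baire_space) ys :=
  code (drop (nth 0 ys 0) (decode (nth 0 ys 1))) == 0.
apply: recursive_ext (recursive_least (P := P) _ _) => [p xs _ _||p xs _ _].
- apply: least_eq => [|m lt_m]; first by rewrite /P /= drop_size.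
  by rewrite /P /= code_eq0 -size_eq0 size_drop subn_eq0 -ltnNge.
- by apply/recursive_neg/recursive_eq0/recursive_drop; exact: recursive_proj.
by exists (size (decode (nth 0 xs 0))); rewrite /P /= drop_size.
Qed.

(** * Computable partial functions *)

Definition partial_on (D : set baire_space) (f : baire_space -> baire_space) :
    pfun :=
  fun p => if `[< D p >] then Some (f p) else None.

Lemma computable_partial_on D f :
  recursive_on D 1 (fun p xs => f p (nth 0 xs 0)) ->
  computable (partial_on D f).
Proof.
move=> [e eP]; exists e => p q; rewrite /partial_on.
by case: asboolP => // Dp [<-] n; exact: eP.
Qed.

Fixpoint subst_oracle (d e : prog) : prog :=
  match e with
  | Oracle => Comp d [:: Proj 0]
  | Comp f gs => Comp (subst_oracle d f) (map (subst_oracle d) gs)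
  | Prec f g => Prec (subst_oracle d f) (subst_oracle d g)
  | Mu f => Mu (subst_oracle d f)
  | e => e
  end.

(** Halting occurs only positively in the clauses of [eval], also in the one for
    searches, so it is preserved by the substitution with no appeal to
    determinacy. *)
Lemma eval_subst_oracle (p q : nat -> nat) d :
  (forall n, eval p d [:: n] (q n)) ->
  forall e xs y, eval q e xs y -> eval p (subst_oracle d e) xs y.
Proof.
move=> dP; fix IH 1 => -[||i||f gs|f g|f] xs y //=.
- by move=> ->; exists [:: nth 0 xs 0].
- move=> [ys [gsP fP]]; exists ys; split; last exact: IH.
  elim: gs ys gsP {fP} => [|g gs IHgs] [|z ys] //= [gz gsP].
  by split; [exact: IH | exact: IHgs].
- elim: (nth 0 xs 0) y => [|n IHn] y /=; first exact: IH.
  by move=> [z [nz gz]]; exists z; split; [exact: IHn | exact: IH].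
- move=> [f0 f_lt]; split=> [|z /f_lt [v fv]]; first exact: IH.
  by exists v; exact: IH.
Qed.

Lemma computable_pcomp (F G : pfun) :
  computable F -> computable G -> computable (pcomp F G).
Proof.
move=> [e eP] [d dP]; exists (subst_oracle d e) => p q.
rewrite /pcomp; case Gp: (G p) => [r|] //= Fr n.
by apply: eval_subst_oracle (eP _ _ Fr n); exact: dP Gp.
Qed.

(** * Branches of Laver trees *)

Lemma unbounded_infinite (A : set nat) :
  (forall n, exists2 m, n <= m & A m) -> infinite_set A.
Proof.
move=> unb /finite_seqP[s As].
have [m] := unb (\max_(i <- s) i).+1; rewrite As /= => lt_m sm.
by have := @leq_bigmax_seq _ s xpredT id m sm isT; rewrite leqNgt lt_m.
Qed.

Definition follow (g : seq nat -> nat) (n : nat) : seq nat :=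
  iter n (fun s => rcons s (g s)) [::].

Lemma mkseq_follow g n : mkseq (fun i => g (follow g i)) n = follow g n.
Proof. by elim: n => // n IHn; rewrite mkseqS IHn. Qed.

(** No node of a Laver tree is a dead end: leave [s] downwards by its own entries
    up to its length, and by some child afterwards. *)
Lemma laver_branch (T : set (seq nat)) s :
  is_laver T -> T s -> exists2 y : baire_space, body T y & cylinder s y.
Proof.
move=> [Tpre _ Tinf] Ts.
pose g t := if size t < size s then nth 0 s (size t)
            else xget 0 [set n | T (rcons t n)].
have sz n : size (follow g n) = n.
  by rewrite -mkseq_follow size_mkseq.
have take_s n : n <= size s -> follow g n = take n s.
  elim: n => [|n IHn] lt_n; first by rewrite take0.
  rewrite /follow /= -/(follow g n) /g sz lt_n (take_nth 0) //.
  by rewrite IHn // ltnW.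
exists (fun i => g (follow g i)); last first.
  by rewrite /cylinder /= mkseq_follow take_s // take_size.
move=> n; rewrite mkseq_follow; elim: n => [|n IHn].
  by apply: Tpre Ts; rewrite prefix0s.
have [lt_n|le_n] := ltnP n (size s).
  by rewrite take_s //; apply: Tpre Ts; exact: prefix_take.
rewrite /follow /= -/(follow g n) /g sz ltnNge le_n /=.
have [m Tm] := infinite_setN0 (Tinf _ IHn).
exact: (xgetPex 0 (ex_intro _ m Tm)).
Qed.

(** * Finding Laver trees by choosing branches *)

(** Reading strings backwards turns initial segments into suffixes, which [drop]
    gives; for [i] past the length, the condition concerns the empty string. *)
Definition zero_tree (x : nat -> nat) : set (seq nat) :=
  [set s | forall i, x (code (drop i (rev s))) = 0].

(** The code of [s] serves as a bound on its length. *)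
Definition zero_mem (x : nat -> nat) (s : seq nat) : bool :=
  all (fun i => x (code (drop i (rev s))) == 0) (iota 0 (code s).+1).

Lemma zero_memP x s : reflect (zero_tree x s) (zero_mem x s).
Proof.
apply: (iffP allP) => [xs i|xs i _]; last by rewrite xs.
have le_s : size s <= code s by rewrite -{1}[s]CodeSeq.codeK size_decode.
have [le_i|lt_i] := leqP i (code s).
  by apply/eqP/xs; rewrite mem_iota.
have := xs (code s); rewrite mem_iota ltnSn => /(_ isT)/eqP.
by rewrite !drop_oversize // size_rev // (leq_trans le_s) // ltnW.
Qed.

Lemma zero_tree_prefix x : prefix_closed (zero_tree x).
Proof.
move=> s _ /prefixP[t ->] xt i.
by have := xt (i + size t); rewrite rev_cat -drop_drop drop_size_cat ?size_rev.
Qed.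

Lemma zero_tree_rcons x s n :
  zero_tree x (rcons s n) <-> zero_tree x s /\ x (code (n :: rev s)) = 0.
Proof.
rewrite /zero_tree /= rev_rcons; split=> [xs|[xs xn] [|i]] //.
  by split=> [i|]; [have := xs i.+1 | have := xs 0].
exact: xs.
Qed.

(** The arithmetic that makes reversed strings convenient: moving to a later
    sibling is a multiplication. *)
Lemma code_shift d n s : code (d + n :: s) = 2 ^ d * code (n :: s).
Proof. by rewrite /= mulnA -expnD. Qed.

(** Starting from the child [n], the value of [x] points to an admissible child
    at or after [n].  At [c = 0] the hypothesis says [x 0 = 0], which puts the
    root in the tree. *)
Lemma zero_tree_laver x :
  (forall c, x (2 ^ x c * c) = 0) -> is_laver (zero_tree x).
Proof.
move=> xP; split; first exact: zero_tree_prefix.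
  by move=> i; have := xP 0; rewrite muln0.
move=> s xs; apply: unbounded_infinite => n.
pose c := code (n :: rev s); exists (x c + n); first exact: leq_addl.
by apply/zero_tree_rcons; split=> //; rewrite code_shift xP.
Qed.

Lemma sub_zero_tree (T : set (seq nat)) (x : nat -> nat) :
  T [::] ->
  (forall s n, T s -> x (code (n :: rev s)) = 0 -> T (rcons s n)) ->
  zero_tree x `<=` T.
Proof.
move=> T0 xT; elim/last_ind => // s n IHs /zero_tree_rcons[xs xn].
by apply: xT => //; exact: IHs.
Qed.

(** The two closed requirements, tested on a finite part [u] of [x].  What [u]
    leaves undefined must not falsify them: in the first a missing value reads as
    0, and in the second it reads as 1, which keeps strings out of the zero
    tree. *)
Definition laver_check (p : baire_space) (u : seq nat) : bool :=
  all (fun c => (nth 0 u (2 ^ nth 0 u c * c) == 0) &&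
    ((p c == 0) || ~~ zero_mem (nth 1 u) (decode (p c).-1)))
    (iota 0 (size u)).

Lemma laver_check_prefix p : prefix_closed (fun u => laver_check p u).
Proof.
move=> u _ /prefixP[v ->] /allP uvP; apply/allP => c.
rewrite mem_iota /= add0n => lt_c.
have /uvP : c \in iota 0 (size (u ++ v)).
  by rewrite mem_iota /= add0n size_cat ltn_addr.
rewrite [nth 0 (u ++ v) c]nth_cat lt_c => /andP[next0 pc]; apply/andP; split.
  have [le_u|lt_u] := leqP (size u) (2 ^ nth 0 u c * c).
    by rewrite nth_default.
  by rewrite nth_cat lt_u in next0.
case/orP: pc => [->//|uvF]; apply/orP; right; apply: contra uvF.
move=> /zero_memP u0; apply/zero_memP => i; have := u0 i.
case: (ltnP (code (drop i (rev (decode (p c).-1)))) (size u)) => [lt_u|le_u].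
  by rewrite nth_cat lt_u.
by rewrite nth_default.
Qed.

Definition laver_search (p : baire_space) : tree :=
  Tree (@laver_check_prefix p).

(** The branch vanishes on the strings of [T] and points elsewhere to a later
    sibling in [T], if there is one. *)
Lemma laver_search_nonempty p (T : set (seq nat)) :
  is_laver T -> body T `<=` ~` enum_open p -> body (laver_search p) !=set0.
Proof.
move=> Tlaver Tp; have [Tpre T0 Tinf] := Tlaver.
pose x c := if `[< T (rev (decode c)) >] then 0
            else xget 0 [set d | T (rev (decode (2 ^ d * c)))].
have xP c : x (2 ^ x c * c) = 0.
  rewrite {2}/x; case: asboolP => [Tc|nTc].
    by rewrite mul1n /x; case: asboolP.
  case: xgetP => [d _ Td|nT]; first by rewrite /x; case: asboolP.
  rewrite mul1n /x; case: asboolP => // _.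
  by case: xgetP => // d _ /nT.
have xT : zero_tree x `<=` T.
  apply: sub_zero_tree => // s n Ts.
  rewrite /x CodeSeq.codeK rev_cons revK; case: asboolP => // _.
  (* A value 0 could also mean that no later sibling is in [T]; infinite
     splitting at [s] excludes this. *)
  have [m [lt_m Tm]] : exists m, n <= m /\ T (rcons s m).
    apply: contrapT => nm; apply: (Tinf _ Ts).
    apply: (@sub_finite_set _ _ `I_n) => [m Tm|]; last exact: finite_II.
    by rewrite /= ltnNge; apply/negP => le_m; apply: nm; exists m.
  case: xgetP => [d -> Td d0|nT _].
    have {d0} : T (rev (decode (2 ^ 0 * code (n :: rev s)))).
      by move: Td; rewrite d0.
    by rewrite expn0 mul1n CodeSeq.codeK rev_cons revK.
  case: (nT (m - n)); rewrite /mkset -code_shift subnK //.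
  by rewrite CodeSeq.codeK rev_cons revK.
exists x => N; apply/allP => c; rewrite mem_iota size_mkseq /= add0n => lt_c.
apply/andP; split.
  rewrite [nth 0 _ c]nth_mkseq //; have [lt_N|le_N] := ltnP (2 ^ x c * c) N.
    by rewrite nth_mkseq // xP.
  by rewrite nth_default // size_mkseq.
case pc: (p c) => [//|m] /=; apply/negP => /zero_memP x0.
have [|y Ty sy] := @laver_branch T (decode m) Tlaver.
  apply: xT => i; have := x0 i.
  case: (ltnP (code (drop i (rev (decode m)))) N) => [lt_N|le_N].
    by rewrite nth_mkseq.
  by rewrite nth_default // size_mkseq.
by apply: Tp Ty _; exists c, (decode m); rewrite CodeSeq.decodeK.
Qed.

(** Each requirement concerns finitely many values of [x], and is tested once
    the initial segment of [x] is long enough. *)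
Lemma body_laver_search p (x : baire_space) : body (laver_search p) x ->
  is_laver (zero_tree x) /\ body (zero_tree x) `<=` ~` enum_open p.
Proof.
move=> xP.
have xP' N c : c < N -> (nth 0 (mkseq x N) (2 ^ x c * c) == 0) &&
    ((p c == 0) || ~~ zero_mem (nth 1 (mkseq x N)) (decode (p c).-1)).
  move=> lt_c; have /allP/(_ c) := xP N.
  by rewrite mem_iota size_mkseq /= add0n [nth 0 _ c]nth_mkseq // => /(_ lt_c).
split.
  apply: zero_tree_laver => c.
  have /xP'/andP[] : c < (c + 2 ^ x c * c).+1 by rewrite ltnS leq_addr.
  by rewrite nth_mkseq ?ltnS ?leq_addl // => /eqP.
move=> y xy [c [s [pc sy]]].
have xs : zero_tree x s by rewrite -sy; exact: xy.
(* A stage at which [c] and the codes of all suffixes of [rev s] have been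
   seen, so that the test at [c] fails. *)
pose N := (c + \max_(i < (code s).+1) code (drop i (rev s))).+1.
have /xP'/andP[_] : c < N by rewrite ltnS leq_addr.
rewrite pc /= CodeSeq.codeK => /negP; apply; apply/allP => i.
rewrite mem_iota /= add0n => lt_i; rewrite nth_mkseq ?xs //.
by rewrite ltnS (leq_trans _ (leq_addl _ _)) // (leq_bigmax (Ordinal lt_i)).
Qed.

Lemma recursive_zero_mem D k (h : baire_space -> nat -> nat -> nat) f g :
  recursive_on D 2 (fun p ys => h p (nth 0 ys 0) (nth 0 ys 1)) ->
  recursive_on D k f -> recursive_on D k g ->
  recursive_on D k (fun p xs => zero_mem (h p (f p xs)) (decode (g p xs))).
Proof.
move=> hP.
apply: (recursive_app2 (f := fun p a c => zero_mem (h p a) (decode c))).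
pose P p ys :=
  h p (nth 0 ys 1) (code (drop (nth 0 ys 0) (rev (decode (nth 0 ys 2))))) == 0.
apply: recursive_ext (recursive_all (P := P)
  (recursive_succ (recursive_proj _ _ 1)) _) => [p xs _ _|].
  by rewrite /zero_mem CodeSeq.decodeK.
apply: recursive_eq0; apply: (recursive_app2 hP); first exact: recursive_proj.
have rP := recursive_rev_map (h := id) (recursive_proj D 1 0)
  (recursive_proj D 3 2).
apply: recursive_ext (recursive_drop (recursive_proj _ _ 0) rP) => p ys _ _.
by rewrite map_id CodeSeq.codeK.
Qed.

Lemma recursive_laver_check :
  recursive_on setT 1 (fun p xs => laver_check p (decode (nth 0 xs 0))).
Proof.
pose P (p : baire_space) ys := let u := decode (nth 0 ys 1) in
  let c := nth 0 ys 0 in (nth 0 u (2 ^ nth 0 u c * c) == 0) &&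
    ((p c == 0) || ~~ zero_mem (nth 1 u) (decode (p c).-1)).
apply: (recursive_all (P := P)); first exact/recursive_size/recursive_proj.
have c := recursive_proj setT 2 0; have u := recursive_proj setT 2 1.
have pc := recursive_oracle c.
apply: recursive_and.
  by apply/recursive_eq0/recursive_nth => //;
     apply/recursive_mul => //; apply/recursive_exp2/recursive_nth.
apply: recursive_or; first exact: recursive_eq0.
apply: recursive_neg.
apply: (recursive_zero_mem (h := fun _ a n => nth 1 (decode a) n)) => //.
  by apply: recursive_nth; exact: recursive_proj.
exact: recursive_pred.
Qed.

(** A branch found in the search tree is turned into a Laver tree, given by its
    characteristic function, and then into a name under [LT]. *)
Lemma FindL_le_C (LT : baire_space -> laver_tree) :
  laver_representation LT -> sW_le (FindL_Pi01 LT) C_baire.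
Proof.
move=> [_ [_ [F cF FP]]].
pose phi := partial_on setT (fun p c => laver_check p (decode c) : nat).
pose psi := partial_on setT (fun x c => zero_mem x (decode c) : nat).
exists phi, (pcomp F psi); split.
- exact/computable_partial_on/recursive_laver_check.
- apply: computable_pcomp => //; apply: computable_partial_on.
  apply: (recursive_zero_mem (h := fun p _ n => p n) (f := fun _ _ => 0)).
  + exact/recursive_oracle/recursive_proj.
  + exact: recursive_const.
  + exact: recursive_proj.
move=> G GP A p [T TA] pA.
have pT q : partial_on setT q =1 Some \o q.
  by move=> r; rewrite /partial_on; case: asboolP => // -[].
have [||q [_ [Gq <- xq]]] :=
  GP (laver_search p) (fun c => laver_check p (decode c) : nat).
- by apply: (laver_search_nonempty (laverP T)); rewrite -pA; exact: TA.
- by move=> s; rewrite CodeSeq.codeK asboolb.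
have [lq qA] := body_laver_search xq.
have [|r Fr LTr] := FP (fun c => zero_mem q (decode c) : nat) (LaverTree lq).
  by move=> s /=; rewrite CodeSeq.codeK; case: zero_memP; case: asboolP.
exists r, r; split=> //; last by rewrite /= LTr pA.
by rewrite /pcomp /= /phi pT /= Gq /= /psi pT.
Qed.

(** * Choosing branches by finding Laver trees *)

(** Any computable function with infinite fibres would do; the head of a coded
    list is at hand, the rest of the list being arbitrary. *)
Definition untag (m : nat) : nat := head 0 (decode m).

Definition untag_name (t : baire_space) : baire_space :=
  fun n => if t (code (map untag (decode n))) == 0 then n.+1 else 0.

Lemma enum_untag_name (t : baire_space) (T : set (seq nat)) (y : baire_space) :
  char_names t T ->
  (~` enum_open (untag_name t)) y <-> body T (untag \o y).
Proof.
move=> tT; have T0 s : (t (code s) == 0) = ~~ `[< T s >].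
  by rewrite tT; case: asboolP.
split=> [ny n|yT [n [s [ns sy]]]].
  rewrite /mkseq map_comp; apply: contrapT => nT; apply: ny.
  exists (code (mkseq y n)), (mkseq y n); split; last exact: cylinder_self.
  by rewrite /untag_name CodeSeq.codeK T0; case: asboolP.
have := yT (size s); rewrite /mkseq map_comp -/(mkseq y (size s)) sy => Ts.
move: ns; rewrite /untag_name; case: ifP => // t0 [] ns.
by move: t0; rewrite ns CodeSeq.codeK T0; case: asboolP.
Qed.

Lemma untag_fibre a n : exists2 m, n <= m & untag m = a.
Proof.
exists (code [:: a; n]); last by rewrite /untag CodeSeq.codeK.
by have /andP[_ /andP[/ltnW]] := CodeSeq.ltn_code [:: a; n].
Qed.

Definition untag_laver (x : baire_space) : set (seq nat) :=
  [set s | map untag s = mkseq x (size s)].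

Lemma untag_laverP x : is_laver (untag_laver x).
Proof.
split=> // [s _ /prefixP[t ->]|s xs].
  rewrite /untag_laver /= map_cat size_cat /mkseq iotaD map_cat => /eqP.
  by rewrite eqseq_cat ?size_map ?size_iota // => /andP[/eqP].
apply: unbounded_infinite => n; have [m le_m mx] := untag_fibre (x (size s)) n.
by exists m => //; rewrite /untag_laver /= map_rcons size_rcons mkseqS xs mx.
Qed.

Lemma body_untag_laver x (y : baire_space) :
  body (untag_laver x) y -> untag \o y = x.
Proof.
move=> xy; apply/funext => n; have := xy n.+1.
rewrite /untag_laver /mkset size_mkseq [mkseq y _]/mkseq -map_comp.
rewrite -/(mkseq _ _).
by move=> /(congr1 (nth 0 ^~ n)); rewrite !nth_mkseq.
Qed.

Definition laver_names : set baire_space :=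
  [set q | exists2 T, is_laver T & char_names q T].

(** The first disjunct makes the search end also at strings outside the tree, so
    that [child] is total on names of Laver trees. *)
Definition child (q : baire_space) (s : seq nat) : nat :=
  least (fun m => (q (code s) == 0) || (q (code (rcons s m)) != 0)).

Definition branch (q : baire_space) : baire_space :=
  fun n => child q (follow (child q) n).

Lemma char_names_neq0 q T s : char_names q T -> (q (code s) != 0) = `[< T s >].
Proof. by move=> qT; rewrite qT; case: asboolP. Qed.

Lemma child_exists q s : laver_names q ->
  exists m, (q (code s) == 0) || (q (code (rcons s m)) != 0).
Proof.
move=> [T [_ _ Tinf] qT].
have [qs|] := eqVneq (q (code s)) 0; first by exists 0.
rewrite (char_names_neq0 _ qT) => /asboolP Ts.
have [m Tm] : [set m | T (rcons s m)] !=set0.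
  exact/infinite_setN0/Tinf.
by exists m; rewrite (char_names_neq0 _ qT); apply/asboolP.
Qed.

Lemma body_branch q T : is_laver T -> char_names q T -> body T (branch q).
Proof.
move=> Tl qT n; rewrite mkseq_follow; have [_ T0 _] := Tl.
elim: n => // n; set s := follow _ n => Ts.
have [+ _] := leastP (child_exists s (ex_intro2 _ _ T Tl qT)).
rewrite -/(child q s) => /orP[/eqP qs|].
  by have := char_names_neq0 s qT; rewrite qs asboolT.
by rewrite (char_names_neq0 _ qT) => /asboolP.
Qed.

Lemma recursive_child k f :
  recursive_on laver_names k f ->
  recursive_on laver_names k (fun p xs => child p (rev (decode (f p xs)))).
Proof.
apply: (recursive_app1 (f := fun p c => child p (rev (decode c)))).
have rP g : recursive_on laver_names 2 g ->
    recursive_on laver_names 2 (fun p ys => p (code (rev (decode (g p ys))))).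
  move=> gP; apply/recursive_oracle.
  have := recursive_rev_map (h := id) (recursive_proj laver_names 1 0) gP.
  by apply: recursive_ext => p ys _ _; rewrite map_id.
pose P (p : baire_space) ys := (p (code (rev (decode (nth 0 ys 1)))) == 0)
  || (p (code (rcons (rev (decode (nth 0 ys 1))) (nth 0 ys 0))) != 0).
apply: (recursive_least (P := P) _ (fun p xs Dp _ =>
  child_exists (rev (decode (nth 0 xs 0))) Dp)).
have r1 := recursive_proj laver_names 2 1.
apply/recursive_neg/recursive_or; first exact/recursive_eq0/rP.
apply/recursive_neg/recursive_eq0.
have cP : recursive_on laver_names 2
    (fun _ ys => code (nth 0 ys 0 :: decode (nth 0 ys 1))).
  apply: recursive_cons; first exact: recursive_proj.
  by apply: recursive_ext r1 => p ys _ _; rewrite CodeSeq.decodeK.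
apply: recursive_ext (rP _ cP) => p ys _ _.
by rewrite CodeSeq.codeK rev_cons.
Qed.

(** The recursion keeps the string in reverse, so that a step is a mere cons. *)
Lemma recursive_branch :
  recursive_on laver_names 1 (fun p xs => branch p (nth 0 xs 0)).
Proof.
have cP : recursive_on laver_names 3 (fun p ys =>
    code (child p (rev (decode (nth 0 ys 1))) :: decode (nth 0 ys 1))).
  apply: recursive_cons; first exact/recursive_child/recursive_proj.
  apply: recursive_ext (recursive_proj _ _ 1) => p ys _ _.
  by rewrite CodeSeq.decodeK.
have fP := recursive_iteri (recursive_proj laver_names 1 0)
  (recursive_const _ _ 0) cP.
apply: recursive_ext (recursive_child fP) => p xs _ _; congr child.
apply: (canLR revK); apply: (canLR CodeSeq.codeK).
elim: (nth 0 xs 0) => // n IHn.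
by rewrite iteriS IHn [follow _ n.+1]/= rev_rcons /= CodeSeq.codeK revK.
Qed.

(** The answer, a name under [LT], is turned into a characteristic function,
    along which a branch is searched and untagged. *)
Lemma C_le_FindL (LT : baire_space -> laver_tree) :
  laver_representation LT -> sW_le C_baire (FindL_Pi01 LT).
Proof.
move=> [_ [[F cF FP] _]].
pose phi := partial_on setT untag_name.
pose psi := partial_on laver_names (fun q => untag \o branch q).
exists phi, (pcomp psi F); split.
- apply: computable_partial_on.
  have x0 := recursive_proj setT 1 0.
  have hP := recursive_head (recursive_proj setT 1 0).
  have rP := recursive_rev_map (h := untag) hP x0.
  have rrP := recursive_rev_map (h := id) (recursive_proj _ _ 0) rP.
  apply: recursive_if (recursive_succ x0) (recursive_const _ _ 0).
  apply/recursive_eq0/recursive_oracle; apply: recursive_ext rrP => p xs _ _.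
  by rewrite map_id CodeSeq.codeK revK.
- apply: computable_pcomp => //; apply: computable_partial_on.
  exact/recursive_head/recursive_branch.
move=> G GP T t [x xT] tT.
pose A := ClosedSet (@closed_enum (untag_name t)).
have [||q [_ [Gq <- qA]]] := GP A (untag_name t).
- exists (LaverTree (untag_laverP x)) => y /body_untag_laver yx.
  by apply/(enum_untag_name _ tT); rewrite yx.
- by [].
have [r Fr rT] := FP q (LT q) erefl.
have rl : laver_names r by exists (LT q) => //; exact: laverP.
exists (untag \o branch r), (untag \o branch r); split=> //.
  rewrite /pcomp /= /phi /partial_on; case: asboolP => [_|[]] //=.
  by rewrite Gq /= Fr /= /psi /partial_on; case: asboolP.
apply/(enum_untag_name _ tT)/qA; exact: (body_branch (laverP (LT q)) rT).
Qed.

Theorem proposition5p4 (LT : baire_space -> laver_tree)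
    (LT_repr : laver_representation LT) :
  sW_equiv (FindL_Pi01 LT) C_baire.
Proof. by split; [exact: FindL_le_C | exact: C_le_FindL]. Qed.
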